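(* Let $A\subset\mathbb{N}^n$ be an affine semigroup, let $p$ be a prime number, and let $N_0\in\mathbb{N}$ be such that $p^{N_0}\mathbf{v}\in A$ for every $\mathbf{v}\in {}^{*p}A$ (such an $N_0$ exists). Then $${}^{*p}A=\bigcup_{F\text{ a face of }C(A)}\left(\widetilde{\frac{A\cap F}{p^{N_0}}}\cap \operatorname{int}(F)\right),$$ where $\widetilde{\frac{A\cap F}{p^{N_0}}}=\{\mathbf{v}\in\overline{A}\mid p^{N_0}\mathbf{v}\in A\cap F\}$.
   Context: $\mathbb{N}$ contains $0$. An affine semigroup is a finitely generated submonoid $A$ of the additive monoid $\mathbb{N}^n$. If $A$ is generated by $\mathbf{a}_1,\dots,\mathbf{a}_s$, then $G(A)\subset\mathbb{Z}^n$ is the subgroup generated by $A$, and $C(A)=\{r_1\mathbf{a}_1+\cdots+r_s\mathbf{a}_s\mid r_i\in\mathbb{R}_{\ge 0}\}$ is its cone. The saturation (normalization) of $A$ is $\overline{A}=G(A)\cap C(A)$. For a prime $p$, the $p$-weak normalization of $A$ is ${}^{*p}A=\{\mathbf{v}\in\overline{A}\mid p^e\mathbf{v}\in A\text{ for some }e\in\mathbb{N}\}$. Faces of $C(A)$ are faces in the usual sense of convex polyhedral cones (including $\{\mathbf 0\}$ and $C(A)$ itself); each face is of the form $F=\{\sum_{j} r_j\mathbf{a}_{i_j}\mid r_j\in\mathbb{R}_{\ge0}\}$ for some subset of the generators, and $\operatorname{int}(F)$ denotes its relative interior (with $\operatorname{int}(\{\mathbf 0\})=\{\mathbf 0\}$).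 *)

(* Defs.v *)
From HB Require Import structures.
From mathcomp Require Import all_boot all_order all_algebra.
From mathcomp Require Import all_classical all_reals all_analysis.

Set Implicit Arguments.
Unset Strict Implicit.
Unset Printing Implicit Defensive.

Import Order.TTheory GRing.Theory Num.Theory.
Import numFieldNormedType.Exports.

Local Open Scope classical_set_scope.
Local Open Scope ring_scope.

Definition is_submonoid (V : nmodType) (M : set V) : Prop :=
  M 0 /\ forall x y, M x -> M y -> M (x + y).

Definition is_subgroup (V : zmodType) (M : set V) : Prop :=
  M 0 /\ forall x y, M x -> M y -> M (x - y).

Definition is_affine (R : realType) (n : nat) (M : set 'rV[R]_n) : Prop :=
  forall (t : R) x y, M x -> M y -> M ((1 - t) *: x + t *: y).

Definition affine_hull (R : realType) (n : nat) (S : set 'rV[R]_n) :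
  set 'rV[R]_n := smallest (@is_affine R n) S.

(* Interior of S for the topology induced on its affine hull; in particular
   the relative interior of a single point is that point. *)
Definition relative_interior (R : realType) (n : nat) (S : set 'rV[R]_n) :
  set 'rV[R]_n :=
  [set x | S x /\ within (affine_hull S) (nbhs x) S].

(* F is cut out of the cone C by a linear form that is nonnegative on C; the
   zero form gives F = C. *)
Definition is_face (R : realType) (n : nat) (C F : set 'rV[R]_n) : Prop :=
  exists u : 'rV[R]_n,
    (forall x, C x -> 0 <= \sum_j u 0 j * x 0 j) /\
    F = C `&` [set x | \sum_j u 0 j * x 0 j = 0].

Definition int_of_natv (n : nat) (v : 'rV[nat]_n) : 'rV[int]_n :=
  map_mx Posz v.

Definition real_of_intv (R : realType) (n : nat) (v : 'rV[int]_n) : 'rV[R]_n :=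
  map_mx (fun z : int => z%:~R) v.

(* An affine semigroup A is given by a finite family a of generators in N^n,
   and A, G(A), C(A) and the sets built from them are indexed by a. A is viewed
   inside Z^n, where its saturation and weak normalizations live. *)
Definition semigroup (n s : nat) (a : 'I_s -> 'rV[nat]_n) : set 'rV[int]_n :=
  @int_of_natv n @` smallest (@is_submonoid 'rV[nat]_n) (range a).

Definition group_of (n s : nat) (a : 'I_s -> 'rV[nat]_n) : set 'rV[int]_n :=
  smallest (@is_subgroup 'rV[int]_n) (semigroup a).

Definition cone (R : realType) (n s : nat) (a : 'I_s -> 'rV[nat]_n) :
  set 'rV[R]_n :=
  [set x | exists r : 'I_s -> R, (forall i, 0 <= r i) /\
     x = \sum_i r i *: real_of_intv R (int_of_natv (a i))].
Arguments cone R {n s} a _.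

Definition saturation (R : realType) (n s : nat) (a : 'I_s -> 'rV[nat]_n) :
  set 'rV[int]_n :=
  group_of a `&` @real_of_intv R n @^-1` cone R a.

Definition weak_normalization (R : realType) (n s : nat)
    (a : 'I_s -> 'rV[nat]_n) (p : nat) : set 'rV[int]_n :=
  [set v | saturation R a v /\ exists e : nat, semigroup a (v *+ (p ^ e)%N)].

(* The points v of the saturation with p ^ N v in both A and F. *)
Definition face_fraction (R : realType) (n s : nat)
    (a : 'I_s -> 'rV[nat]_n) (p N : nat) (F : set 'rV[R]_n) :
  set 'rV[int]_n :=
  [set v | saturation R a v /\
     (semigroup a `&` @real_of_intv R n @^-1` F) (v *+ (p ^ N)%N)].

(* Main.v *)
(* A point v of the saturation is a nonnegative real combination of the
   generators; taking integer parts writes v as b + c . a with c natural and b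
   in a finite set.  By Dickson's lemma a sequence v_N of points of the
   p-weak normalization has an increasing subsequence with b constant, along
   which the differences of terms lie in A, so an exponent good for one term is
   good for all later ones: the exponents are bounded.

   For the decomposition, every point x of a finitely generated cone is in the
   relative interior of an exposed face: take a combination x = r . g with as
   many positive coefficients as possible; Farkas' lemma gives a form vanishing
   exactly on the generators with positive coefficient, and these still have
   positive coefficients for all points of their span close to x. *)
Require Import Defs.
From HB Require Import structures.
From mathcomp Require Import all_boot all_order all_algebra.
From mathcomp Require Import all_classical all_reals all_analysis.
From mathcomp Require Import ring lra.

Set Implicit Arguments.
Unset Strict Implicit.
Unset Printing Implicit Defensive.

Import Order.TTheory GRing.Theory Num.Theory.
Import numFieldNormedType.Exports.

Local Open Scope classical_set_scope.
Local Open Scope ring_scope.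

(** * Monotone subsequences and Dickson's lemma *)

Lemma nat_nondecreasing_subseq (f : nat -> nat) :
  exists phi : nat -> nat, {homo phi : i j / (i < j)%N} /\
    {homo f \o phi : i j / (i <= j)%N}.
Proof.
(* Beyond every [N] there is an index where [f] attains its minimum over the tail from [N]; [phi]
   jumps from one such index to the next. *)
have good N : exists t, (N <= t)%N /\ forall k, (t <= k)%N -> (f t <= f k)%N.
  have [|_ [[t /= Nt <-] tmin]] :=
    @nat_has_minimum (f @` [set k | (N <= k)%N]).
    by exists (f N), N => /=.
  exists t; split=> // k tk; apply: tmin; exists k => //=.
  exact: leq_trans tk.
have [g gP] := choice good.
pose phi i := iter i (g \o succn) (g 0).
have phi_lt : {homo phi : i j / (i < j)%N}.
  apply: homo_ltn => [y x z|i]; first exact: ltn_trans.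
  by rewrite [phi i.+1]iterS /=; have [] := gP (phi i).+1.
exists phi; split=> // i j; rewrite leq_eqVlt => /predU1P[-> //|/phi_lt ij].
have [N good_i] : exists N, phi i = g N.
  by case: (i) => [|k]; [exists 0%N|exists (phi k).+1].
by move: (ltnW ij); rewrite /= good_i; apply: (gP _).2.
Qed.

(** The subsequence is refined for one coordinate after the other; refining keeps the earlier
    coordinates monotone. *)
Lemma dickson_subseq (T : finType) (f : nat -> T -> nat) :
  exists phi : nat -> nat, {homo phi : i j / (i < j)%N} /\
    forall t, {homo (fun k => f (phi k) t) : i j / (i <= j)%N}.
Proof.
suff H (l : seq T) : exists phi : nat -> nat, {homo phi : i j / (i < j)%N} /\
    forall t, t \in l -> {homo (fun k => f (phi k) t) : i j / (i <= j)%N}.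
  have [phi [phi_lt phi_le]] := H (enum T).
  by exists phi; split=> // t; apply: phi_le; rewrite mem_enum.
elim: l => [|t l [phi [phi_lt phi_le]]]; first by exists id; split.
have [psi [psi_lt psi_le]] := nat_nondecreasing_subseq (fun k => f (phi k) t).
exists (phi \o psi); split=> [i j ij|u]; first exact/phi_lt/psi_lt.
rewrite inE => /predU1P[->//|ul] i j ij.
by apply: phi_le => //; apply: (ltnW_homo psi_lt).
Qed.

(** * The semigroup and integer parts of conic combinations *)

Lemma int_of_natvD n (v w : 'rV[nat]_n) :
  int_of_natv (v + w) = int_of_natv v + int_of_natv w.
Proof. by apply/rowP => j; rewrite !mxE. Qed.

Lemma real_of_intv_is_zmod_morphism (R : realType) n :
  zmod_morphism (@real_of_intv R n).
Proof. by move=> v w; apply/rowP => j; rewrite !mxE intrB. Qed.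

HB.instance Definition _ (R : realType) n :=
  GRing.isZmodMorphism.Build _ _ (@real_of_intv R n)
    (@real_of_intv_is_zmod_morphism R n).

Section Semigroup.
Variables (n s : nat) (a : 'I_s -> 'rV[nat]_n).

Lemma semigroup0 : semigroup a 0.
Proof.
exists 0; first by move=> M [[M0 _] _].
by apply/rowP => j; rewrite !mxE.
Qed.

Lemma semigroupD v w : semigroup a v -> semigroup a w -> semigroup a (v + w).
Proof.
move=> [x Sx <-] [y Sy <-]; exists (x + y); last exact: int_of_natvD.
move=> M [subM aM]; apply: subM.2; [exact: Sx | exact: Sy].
Qed.

Lemma semigroupMn v k : semigroup a v -> semigroup a (v *+ k).
Proof.
move=> Sv; elim: k => [|k IHk]; first exact: semigroup0.
by rewrite mulrS; apply: semigroupD.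
Qed.

Lemma semigroup_gen i : semigroup a (int_of_natv (a i)).
Proof. by exists (a i) => // M [_]; apply; exists i. Qed.

Lemma semigroup_sum (c : 'I_s -> nat) :
  semigroup a (\sum_i int_of_natv (a i) *+ c i).
Proof.
by elim/big_ind: _ => [||i _]; [exact: semigroup0 | exact: semigroupD |
  exact/semigroupMn/semigroup_gen].
Qed.

Variable R : realType.

Lemma cone_decomposition (v : 'rV[int]_n) : cone R a (real_of_intv R v) ->
  exists cb : ('I_s -> nat) * 'rV[nat]_n,
    v = int_of_natv cb.2 + \sum_i int_of_natv (a i) *+ cb.1 i /\
    forall j, (cb.2 0%R j <= \sum_i a i 0%R j)%N.
Proof.
move=> [r [r0 vr]].
pose c i := Num.truncn (r i).
pose w := v - \sum_i int_of_natv (a i) *+ c i.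
(* The remainder [w] is the combination of the generators by fractional parts, so each coordinate
   lies between 0 and the sum over the generators. *)
have wE j : (w 0 j)%:~R = \sum_i (r i - (c i)%:R) * (a i 0 j)%:R :> R.
  have /rowP/(_ j) := vr; rewrite !mxE summxE => vj.
  rewrite intrD intrN vj !summxE rmorph_sum -sumrB; apply: eq_bigr => i _.
  rewrite !mxE mulrBl mulmxnE !mxE rmorphMn /=.
  by rewrite -[(a i 0 j)%:~R]/((a i 0 j)%:R) mulr_natl.
have r_itv i : 0 <= r i - (c i)%:R <= 1.
  have /andP[lo hi] := truncn_itv (r0 i).
  by rewrite subr_ge0 lo lerBlDr -nat1r in hi *; rewrite ltW.
have w_ge0 j : 0 <= w 0 j.
  rewrite -(ler0z R) wE; apply: sumr_ge0 => i _; apply: mulr_ge0 => //.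
  by case/andP: (r_itv i).
exists (c, \row_j `|w 0%R j|%N); split=> [|j] /=.
  rewrite (_ : int_of_natv _ = w) ?subrK//.
  by apply/rowP => j; rewrite 2!mxE; apply: gez0_abs.
rewrite mxE -(ler_nat R) -[X in X <= _]/((`|w 0%R j|%N : int)%:~R).
rewrite gez0_abs// wE.
rewrite natr_sum; apply: ler_sum => i _; rewrite ler_piMl//.
by case/andP: (r_itv i).
Qed.

End Semigroup.

(** * Boundedness of the exponents *)

Lemma weak_normalization_uniform_exponent (R : realType) (n s : nat)
    (a : 'I_s -> 'rV[nat]_n) (p : nat) :
  exists N0 : nat, forall v : 'rV[int]_n,
    weak_normalization R a p v -> semigroup a (v *+ (p ^ N0)%N).
Proof.
apply: contrapT => noN.
have bad N : exists v, weak_normalization R a p v /\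
    ~ semigroup a (v *+ (p ^ N)%N).
  apply: contrapT => badN; apply: noN; exists N => v Wv.
  by apply: contrapT => Sv; apply: badN; exists v.
have [v vP] := choice bad.
have [cb cbP] := choice (fun N => cone_decomposition (vP N).1.1.2).
pose m j := (\sum_i a i 0%R j)%N.
(* Recording both the remainder b and m - b forces b to be constant along
     the subsequence. *)
pose f N (t : 'I_s + ('I_n + 'I_n)) := match t with
  | inl i => (cb N).1 i
  | inr (inl j) => (cb N).2 0%R j
  | inr (inr j) => (m j - (cb N).2 0%R j)%N
  end.
have [phi [phi_lt phi_le]] := dickson_subseq f.
have [[_ [e Se]] _] := vP (phi 0%N).
(* The exponent [e] works for the term at [phi 0]. The contradiction comes at [phi e], whose
   exponent is at least [e] because [phi] is strictly increasing. *)
have e_le : (e <= phi e)%N.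
  elim: (e) => // k IHk; apply: leq_ltn_trans IHk _; exact: phi_lt.
case: (vP (phi e)) => _; apply.
have [v0E b0_le] := cbP (phi 0%N); have [veE be_le] := cbP (phi e).
have bE : (cb (phi e)).2 = (cb (phi 0%N)).2.
  apply/rowP => j; apply/eqP; rewrite eqn_leq.
  have := phi_le (inr (inl j)) _ _ (leq0n e); rewrite /f => ->; rewrite andbT.
  have := phi_le (inr (inr j)) _ _ (leq0n e); rewrite /f.
  by rewrite leq_subLR addnC -leq_subLR subKn// /m => ->.
have -> : v (phi e) = v (phi 0%N) +
    \sum_i int_of_natv (a i) *+ ((cb (phi e)).1 i - (cb (phi 0%N)).1 i)%N.
  rewrite veE v0E bE -addrA -big_split /=; congr (_ + _); apply: eq_bigr => i _.
  by rewrite -mulrnDr subnKC//; exact: (phi_le (inl i) _ _ (leq0n e)).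
rewrite mulrnDl; apply: semigroupD; last exact/semigroupMn/semigroup_sum.
by rewrite -(subnKC e_le) expnD mulrnA; apply: semigroupMn.
Qed.

(** * Linear forms and Farkas' lemma *)

Definition dot (R : comNzRingType) n (u x : 'rV[R]_n) : R :=
  \sum_j u 0 j * x 0 j.

Lemma dotC (R : comNzRingType) n (u x : 'rV[R]_n) : dot u x = dot x u.
Proof. by apply: eq_bigr => j _; rewrite mulrC. Qed.

Lemma dot_is_scalar (R : comNzRingType) n (u : 'rV[R]_n) : scalar (dot u).
Proof.
move=> c x y; rewrite /dot mulr_sumr -big_split; apply: eq_bigr => j _ /=.
by rewrite !mxE mulrDr mulrCA.
Qed.

HB.instance Definition _ (R : comNzRingType) n (u : 'rV[R]_n) :=
  GRing.isLinear.Build R 'rV[R]_n R *%R (dot u) (dot_is_scalar u).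

Lemma dotZr (R : comNzRingType) n (u x : 'rV[R]_n) c :
  dot u (c *: x) = c * dot u x.
Proof. exact: linearZ. Qed.

Lemma dotBZr (R : comNzRingType) n (u x y : 'rV[R]_n) c :
  dot u (x - c *: y) = dot u x - c * dot u y.
Proof. by rewrite linearB/= dotZr. Qed.

Lemma dotBZl (R : comNzRingType) n (u v x : 'rV[R]_n) c :
  dot (u - c *: v) x = dot u x - c * dot v x.
Proof. by rewrite dotC dotBZr ![dot x _]dotC. Qed.

(* Bartl's proof: if the family without [k] does not already force
   [0 <= dot u b], a witness [x] has [dot x (g k) < 0], and projecting along
   [g k] onto the hyperplane orthogonal to [x] leaves one vector fewer. *)
Lemma farkas_seq (R : realFieldType) n (I : eqType) (l : seq I)
    (g : I -> 'rV[R]_n) (b : 'rV[R]_n) : uniq l ->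
  (forall u, (forall i, i \in l -> 0 <= dot u (g i)) -> 0 <= dot u b) ->
  exists r : I -> R, (forall i, 0 <= r i) /\ b = \sum_(i <- l) r i *: g i.
Proof.
elim: l g b => [|k l IHl] g b /=.
  move=> _ b_ge0; exists (fun=> 0); split=> //; rewrite big_nil.
  have: dot (- b) b >= 0 by apply: b_ge0.
  rewrite dotC linearN oppr_ge0 => bb_le0.
  have pos j : true -> 0 <= b 0 j * b 0 j by rewrite -expr2 sqr_ge0.
  have bb0 : dot b b = 0.
    by apply/le_anti; rewrite bb_le0; apply: sumr_ge0.
  apply/rowP => j; rewrite mxE.
  have /eqP := psumr_eq0P pos bb0 (erefl : xpredT j).
  by rewrite mulf_eq0 orbb => /eqP.
move=> /andP[knl ul] gb.
have sum_if (r : I -> R) t :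
    \sum_(i <- k :: l) (if i == k then t else r i) *: g i =
    t *: g k + \sum_(i <- l) r i *: g i.
  rewrite big_cons eqxx; congr (_ + _); apply: eq_big_seq => i il.
  by case: eqP il knl => // -> ->.
have [lb|] := pselect (forall u, (forall i, i \in l -> 0 <= dot u (g i)) ->
    0 <= dot u b).
  have [r [r0 ->]] := IHl _ _ ul lb.
  exists (fun i => if i == k then 0 else r i).
  by split=> [i|]; [case: eqP | rewrite sum_if scale0r add0r].
move/existsNP => [x /not_implyP[xl /negP]]; rewrite -ltNge => xb.
set c := dot x (g k).
have c0 : c < 0.
  rewrite ltNge; apply/negP => c0; move: xb; rewrite ltNge gb// => i.
  by rewrite inE => /predU1P[->//|]; apply: xl.
pose proj y := y - (dot x y / c) *: g k.
(* Moving the projection to the form subtracts a multiple of [x], which makes the form vanish at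
   [g k] and keeps its values on the projected vectors. *)
have dot_proj u y : dot u (proj y) = dot (u - (dot u (g k) / c) *: x) y.
  by rewrite dotBZr dotBZl; ring.
have [u ul0|r [r0 br]] := IHl (proj \o g) (proj b) ul.
  rewrite dot_proj; apply: gb => i; rewrite inE => /predU1P[->|il].
    by rewrite dotBZl -/c divfK ?subrr// lt_eqF.
  by rewrite -dot_proj; apply: ul0.
(* The coefficient of [g k] after undoing the projections: [dot x b / c] is positive, every
   [dot x (g i) / c] is at most 0. *)
pose rk := dot x b / c - \sum_(i <- l) r i * (dot x (g i) / c).
exists (fun i => if i == k then rk else r i).
split=> [i|].
  case: eqP => // _; rewrite subr_ge0 (@le_trans _ _ 0)//.
    rewrite big_seq; apply: sumr_le0 => j jl.
    by rewrite mulr_ge0_le0// mulr_ge0_le0 ?xl// invr_le0 ltW.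
  by apply: mulr_le0; rewrite ?invr_le0 ltW.
rewrite sum_if scalerBl scaler_suml addrAC -addrA -sumrB.
rewrite -[LHS](subrK ((dot x b / c) *: g k)) -/(proj b) br addrC; congr (_ + _).
by apply: eq_bigr => i _; rewrite /proj/= scalerBr scalerA.
Qed.

Lemma farkas (R : realFieldType) n (I : finType) (g : I -> 'rV[R]_n) b :
  (forall u, (forall i, 0 <= dot u (g i)) -> 0 <= dot u b) ->
  exists r : I -> R, (forall i, 0 <= r i) /\ b = \sum_i r i *: g i.
Proof.
move=> gb; apply: farkas_seq => [|u ug]; first exact: index_enum_uniq.
by apply: gb => i; apply: ug; rewrite mem_index_enum.
Qed.

(** * Relative interiors of faces of a finitely generated cone *)

Lemma mulmx_coord_continuous (R : realType) m n (M : 'M[R]_(m, n)) i :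
  continuous (fun y : 'rV[R]_m => (y *m M) 0 i).
Proof.
under [X in continuous X]eq_fun do rewrite mxE.
apply: continuous_big => [|k _ y]; first exact: add_continuous.
exact: cvgMl (@coord_continuous R 1 m 0 k y).
Qed.

Section ConeFaces.
Variables (R : realType) (n s : nat) (g : 'I_s -> 'rV[R]_n).

Definition conic : set 'rV[R]_n :=
  [set x | exists r : 'I_s -> R, (forall i, 0 <= r i) /\ x = \sum_i r i *: g i].

(** The average of two combinations of [x] is positive wherever one of them is, so averaging
    collects all possible positive coefficients. *)
Lemma maximal_conic_combination x : conic x -> exists r : 'I_s -> R,
  [/\ forall i, 0 <= r i, x = \sum_i r i *: g i &
   forall i (q : 'I_s -> R), (forall k, 0 <= q k) -> x = \sum_k q k *: g k ->
     0 < q i -> 0 < r i].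
Proof.
move=> [r0 [r00 xr0]].
suff H (l : seq 'I_s) : exists r : 'I_s -> R,
  [/\ forall i, 0 <= r i, x = \sum_i r i *: g i &
   forall i (q : 'I_s -> R), i \in l ->
     (forall k, 0 <= q k) -> x = \sum_k q k *: g k -> 0 < q i -> 0 < r i].
  have [r [r_ge0 xr rmax]] := H (enum 'I_s).
  by exists r; split=> // i q; apply: rmax; rewrite mem_enum.
elim: l => [|k l [r [r_ge0 xr rmax]]]; first by exists r0.
have [[q [q_ge0 xq qk]]|noq] := pselect (exists q : 'I_s -> R,
    [/\ forall i, 0 <= q i, x = \sum_i q i *: g i & 0 < q k]); last first.
  exists r; split=> // i q; rewrite inE => /predU1P[-> q_ge0 xq qk|].
    by exfalso; apply: noq; exists q.
  exact: rmax.
exists (fun i => (r i + q i) / 2); split=> [i||i q'].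
- by rewrite divr_ge0// addr_ge0.
- rewrite [LHS](_ : x = 2^-1 *: (x + x)); last first.
    by rewrite scalerDr -scalerDl -[2^-1]mul1r -splitr scale1r.
  rewrite {1}xr xq -big_split scaler_sumr; apply: eq_bigr => i _ /=.
  by rewrite -scalerDl scalerA mulrC.
rewrite inE => /predU1P[-> *|il q'_ge0 xq' q'i].
  by rewrite divr_gt0// ltr_wpDl.
by rewrite divr_gt0// ltr_wpDr// (rmax i q').
Qed.

Lemma supporting_form x (r : 'I_s -> R) :
  (forall i, 0 <= r i) -> x = \sum_i r i *: g i ->
  (forall i (q : 'I_s -> R), (forall k, 0 <= q k) -> x = \sum_k q k *: g k ->
     0 < q i -> 0 < r i) ->
  exists u, [/\ forall i, 0 <= dot u (g i), dot u x = 0 &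
    forall i, r i = 0 -> 0 < dot u (g i)].
Proof.
move=> r_ge0 xr rmax.
have sep k : r k = 0 -> exists u,
    [/\ forall i, 0 <= dot u (g i), dot u x = 0 & 0 < dot u (g k)].
  (* Farkas' lemma is applied to [- g k] and the cone over [- x] and all [g i]: either a form
     separates them, or [x] has a combination that contradicts the maximality of [r]. *)
  move=> rk; pose h (o : unit + 'I_s) := if o is inr i then g i else - x.
  have [hk|/existsNP[u /not_implyP[uh /negP]]] := pselect (forall u,
      (forall o, 0 <= dot u (h o)) -> 0 <= dot u (- g k)); last first.
    rewrite linearN oppr_ge0 -ltNge => uk; exists u; split=> //.
    - by move=> i; apply: (uh (inr i)).
    - apply/le_anti; rewrite -oppr_ge0 -linearN (uh (inl tt))/= xr linear_sum/=.
      apply: sumr_ge0 => i _; rewrite dotZr mulr_ge0//; exact: (uh (inr i)).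
  have [q [q_ge0 gkE]] := farkas hk.
  (* (1 + q (inl tt)) x = x + g k + (a conic combination), so [x] itself has a
     conic combination with a positive coefficient at [k]. *)
  pose t := (1 + q (inl tt))^-1.
  have t0 : 0 < t by rewrite invr_gt0 ltr_wpDr.
  pose q' i := t * (r i + (i == k)%:R + q (inr i)).
  suff: 0 < r k by rewrite rk ltxx.
  apply: (rmax k q') => [i||].
  - by rewrite mulr_ge0 ?addr_ge0// ltW.
  - rewrite big_sumType (big_pred1 tt) /= in gkE; last by case.
    have gkS : \sum_i (i == k)%:R *: g i = g k.
      rewrite (bigD1 k)//= eqxx scale1r big1 ?addr0// => i /negPf->.
      by rewrite scale0r.
    have -> : \sum_i q' i *: g i =
        t *: (x + g k + \sum_i q (inr i) *: g i).
      rewrite xr -[in RHS]gkS -!big_split scaler_sumr; apply: eq_bigr => i _ /=.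
      by rewrite -!scalerDl scalerA.
    have -> : \sum_i q (inr i) *: g i = q (inl tt) *: x - g k.
      by rewrite gkE scalerN addNKr.
    rewrite addrACA subrr addr0 -{2}[x]scale1r -scalerDl scalerA.
    by rewrite mulVf ?scale1r// -invr_eq0 lt0r_neq0.
  - by rewrite mulr_gt0// eqxx ltr_wpDr// ltr_wpDl.
(* Adding the forms found for the single indices gives one form for all of them. *)
suff H (l : seq 'I_s) : exists u, [/\ forall i, 0 <= dot u (g i), dot u x = 0 &
    forall i, i \in l -> r i = 0 -> 0 < dot u (g i)].
  have [u [ug ux ul]] := H (enum 'I_s).
  by exists u; split=> // i; apply: ul; rewrite mem_enum.
have dotDl u v y : dot (u + v) y = dot u y + dot v y.
  by rewrite ![dot _ y]dotC linearD.
elim: l => [|k l [u [ug ux ul]]].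
  by exists 0; split=> // [i|]; rewrite dotC linear0.
have [rk|rk] := eqVneq (r k) 0; last first.
  exists u; split=> // i; rewrite inE => /predU1P[->|]; last exact: ul.
  by move/eqP; rewrite (negPf rk).
have [v [vg vx vk]] := sep k rk.
exists (u + v); split=> [i||i]; rewrite dotDl ?addr_ge0 ?ux ?vx ?addr0//.
rewrite inE => /predU1P[-> _|il ri]; first by rewrite ltr_wpDl.
by rewrite ltr_wpDr// ul.
Qed.

Lemma conic_relative_interior x : conic x ->
  exists2 F, is_face conic F & relative_interior F x.
Proof.
move=> Cx; have [r [r_ge0 xr rmax]] := maximal_conic_combination Cx.
have [u [ug ux upos]] := supporting_form r_ge0 xr rmax.
have uC y : conic y -> 0 <= dot u y.
  move=> [q [q_ge0 ->]]; rewrite linear_sum/=; apply: sumr_ge0 => i _.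
  by rewrite dotZr mulr_ge0.
pose F := conic `&` [set y | dot u y = 0].
exists F; first by exists u.
split; first by split; [exact: Cx | exact: ux].
(* The rows scaled by [r i] drop the generators outside the face; the row space of [W] contains [F]
   and hence its affine hull. *)
pose W : 'M[R]_(s, n) := \matrix_i (r i *: g i).
have mulW (t : 'rV[R]_s) : t *m W = \sum_i (t 0 i * r i) *: g i.
  by rewrite mulmx_sum_row; apply: eq_bigr => i _; rewrite rowK scalerA.
have uW i : dot u (r i *: g i) = 0.
  have pos j : true -> 0 <= dot u (r j *: g j) by rewrite dotZr mulr_ge0.
  by apply: (psumr_eq0P pos) => //; rewrite -linear_sum -xr.
have xW : (x <= W)%MS.
  apply/submxP; exists (const_mx 1); rewrite mulW xr.
  by apply: eq_bigr => i _; rewrite mxE mul1r.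
have hullW y : affine_hull F y -> (y <= W)%MS.
  move=> /(_ [set y | (y <= W)%MS]); apply; split=> [t y1 y2|] /=.
    by move=> y1W y2W; rewrite addmx_sub ?scalemx_sub.
  move=> _ [[q [q_ge0 ->]] /=]; rewrite linear_sum/= => uq.
  have pos j : true -> 0 <= dot u (q j *: g j) by rewrite dotZr mulr_ge0.
  apply/submxP; exists (\row_i (q i / r i)); rewrite mulW.
  apply: eq_bigr => i _; rewrite mxE.
  have [ri|ri] := eqVneq (r i) 0; last by rewrite divfK.
  have /eqP := psumr_eq0P pos uq (erefl true) : dot u (q i *: g i) = 0.
  rewrite dotZr mulf_eq0 (gt_eqF (upos _ ri)) orbF => /eqP->.
  by rewrite !mul0r.
(* Coordinates of [y - x] in the rows of [W]. They are continuous and vanish at [x], so near [x] the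
   coefficients [(1 + t y i) * r i] of [y] stay nonnegative. *)
pose t (y : 'rV[R]_n) i := ((y - x) *m pinvmx W) 0 i.
have near_t : \forall y \near (x : 'rV[R]_n), forall i, `|t y i| < 1.
  apply: (@filter_forall 'rV[R]_n 'I_s (fun i y => `|t y i| < 1) (nbhs x) _).
  move=> i; have /cvgr_dist_lt/(_ _ ltr01) :=
    @mulmx_coord_continuous R n s (pinvmx W) i x.
  apply: filterS => y; rewrite distrC.
  suff -> : t y i = (y *m pinvmx W) 0 i - (x *m pinvmx W) 0 i by [].
  by rewrite /t mulmxBl !mxE.
rewrite /within/=; near=> y => /hullW yW.
have yE : y = \sum_i ((1 + t y i) * r i) *: g i.
  rewrite -[LHS](subrK x) -[y - x](@mulmxKpV _ _ _ _ _ W); last first.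
    by apply: addmx_sub; rewrite ?eqmx_opp.
  rewrite mulW [X in _ + X]xr -big_split; apply: eq_bigr => i _ /=.
  by rewrite -scalerDl mulrDl mul1r addrC.
have t_lt i : `|t y i| < 1 by move: i; near: y.
split=> /=.
  exists (fun i => (1 + t y i) * r i); split=> // i.
  by rewrite mulr_ge0//; have := t_lt i; rewrite ltr_norml => /andP[? ?]; lra.
rewrite yE linear_sum/= big1// => i _.
by rewrite -scalerA dotZr uW mulr0.
Unshelve. all: by end_near.
Qed.

End ConeFaces.

Theorem theorem1 (R : realType) (n s : nat) (a : 'I_s -> 'rV[nat]_n)
    (p : nat) (hp : prime p) :
  (exists N0 : nat, forall v : 'rV[int]_n,
     weak_normalization R a p v -> semigroup a (v *+ (p ^ N0)%N)) /\
  (forall N0 : nat,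
     (forall v : 'rV[int]_n,
        weak_normalization R a p v -> semigroup a (v *+ (p ^ N0)%N)) ->
     weak_normalization R a p =
     \bigcup_(F in [set F : set 'rV[R]_n | is_face (cone R a) F])
       (face_fraction a p N0 F `&`
        @real_of_intv R n @^-1` relative_interior F)).
Proof.
split=> [|N0 N0P]; first exact: weak_normalization_uniform_exponent.
apply/seteqP; split=> [v Wv|v [F _ [[satv [Sv _]] _]]]; last first.
  by split; last exists N0.
have [satv _] := Wv; have [_ Cv] := satv.
have [F faceF Fv] := conic_relative_interior Cv.
exists F => //; split=> //; split=> //; split; first exact: N0P.
have [u [_ FE]] := faceF; case: Fv; rewrite {1}FE => -[[r [r_ge0 vr]] uv] _.
(* The cone and the zero set of the form are both stable under multiplication by [p ^ N0]. *)
rewrite /= FE; split.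
  exists (fun i => r i *+ (p ^ N0)%N); split=> [i|].
    by rewrite mulrn_wge0.
  rewrite raddfMn/= vr -sumrMnl; apply: eq_bigr => i _.
  by rewrite scalerMnl.
by rewrite /= -/(dot u _) !raddfMn/= [dot u _]uv mul0rn.
Qed.
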